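(* Let $\alpha,\beta$ be positive real numbers whose BCF expansion is infinite. Then there is exactly one Fibonacci Tree representation $(\{a_i\}_{i\ge 0},\{b_i\}_{i\ge 0})$ of $(\alpha,\beta)$ which satisfies the conditions (i) $a_i\ge 1$ and $a_i\ge b_i$ for all $i\ge 1$, and (ii) for every $n\ge 1$, $a_n=b_n$ implies $b_{n+1}\neq 0$.
   Context: BCF expansion: for positive reals $\alpha,\beta$, put $\alpha_0=\alpha$, $\beta_0=\beta$ and, for $i\ge 0$, $a_i=\lfloor\alpha_i\rfloor$, $b_i=\lfloor\beta_i\rfloor$, $\alpha_{i+1}=1/(\beta_i-b_i)$, $\beta_{i+1}=(\alpha_i-a_i)/(\beta_i-b_i)$. The algorithm stops at the first $n$ for which $\beta_n$ is an integer (the expansion is then called finite); if no $\beta_n$ is an integer, the expansion is infinite and is the ordered pair of sequences $(\{a_i\}_{i\ge 0},\{b_i\}_{i\ge 0})$. Fibonacci Tree sum: the ordered pair of real numbers $[\{a_0,\ldots,a_{n-1},x\},\{b_0,\ldots,b_{n-1},y\}]$ is defined recursively by $[\{x\},\{y\}]=(x,y)$ and, for $n\ge 1$, $[\{a_0,\ldots,a_{n-1},x\},\{b_0,\ldots,b_{n-1},y\}]=[\{a_0,\ldots,a_{n-2},a_{n-1}+y/x\},\{b_0,\ldots,b_{n-2},b_{n-1}+1/x\}]$. Fibonacci Tree representation: an ordered pair of (infinite) non-negative integer sequences $(\{a_i\}_{i\ge0},\{b_i\}_{i\ge0})$ is a Fibonacci Tree representation of $(\alpha,\beta)$ if the sums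 $(\alpha^{(n)},\beta^{(n)})=[\{a_0,\ldots,a_n\},\{b_0,\ldots,b_n\}]$ satisfy $\lim_{n\to\infty}(\alpha^{(n)},\beta^{(n)})=(\alpha,\beta)$. *)

(* Defs.v *)
From HB Require Import structures.
From mathcomp Require Import all_boot all_order all_algebra.
From mathcomp Require Import all_classical all_reals all_analysis.

Set Implicit Arguments.
Unset Strict Implicit.
Unset Printing Implicit Defensive.

Import Order.TTheory GRing.Theory Num.Theory.
Import numFieldNormedType.Exports.

Local Open Scope classical_set_scope.
Local Open Scope ring_scope.

(* One step of the bifurcating continued fraction (BCF) algorithm,
   (alpha_i, beta_i) |-> (alpha_{i+1}, beta_{i+1}). Since 0^-1 = 0, it is
   total; it agrees with the algorithm as long as beta_i is not an integer. *)
Definition bcf_step (R : realType) (p : R * R) : R * R :=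
  (1 / (p.2 - (Num.floor p.2)%:~R),
   (p.1 - (Num.floor p.1)%:~R) / (p.2 - (Num.floor p.2)%:~R)).

Definition bcf_alpha (R : realType) (alpha beta : R) (i : nat) : R :=
  (iter i (@bcf_step R) (alpha, beta)).1.

Definition bcf_beta (R : realType) (alpha beta : R) (i : nat) : R :=
  (iter i (@bcf_step R) (alpha, beta)).2.

(* The first n at which beta_n is an integer, if any, is reached through
   genuine steps only, so this says exactly that the algorithm never stops. *)
Definition bcf_infinite (R : realType) (alpha beta : R) : Prop :=
  forall n : nat, bcf_beta alpha beta n \isn't a Num.int.

(* ft_sum a b n x y is the Fibonacci Tree sum
   [{a_0, ..., a_{n-1}, x}, {b_0, ..., b_{n-1}, y}]. *)
Fixpoint ft_sum (R : realType) (a b : nat -> R) (n : nat) (x y : R) : R * R :=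
  if n is m.+1 then ft_sum a b m (a m + y / x) (b m + 1 / x) else (x, y).

(* The pair (alpha^(n), beta^(n)). When a_i >= 1 for all i >= 1, every divisor
   occurring in the sum is at least 1, so the convention 0^-1 = 0 is not used. *)
Definition ft_convergent (R : realType) (a b : nat -> nat) (n : nat) : R * R :=
  ft_sum (fun i => (a i)%:R) (fun i => (b i)%:R) n (a n)%:R (b n)%:R.

Definition ft_representation (R : realType) (alpha beta : R)
    (a b : nat -> nat) : Prop :=
  ft_convergent R a b n @[n --> \oo] --> (alpha, beta).

(* Main.v *)
Require Import Defs.
From HB Require Import structures.
From mathcomp Require Import all_boot all_order all_algebra.
From mathcomp Require Import all_classical all_reals all_analysis.
From mathcomp Require Import ring lra.

(** Existence: the convergents of the BCF digits are p_n / c_n, where p and c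
    satisfy u_n = a_n u_(n-1) + b_n u_(n-2) + u_(n-3). Hence each convergent is a
    weighted average of the three preceding ones, and since a_n >= b_n, a_n >= 1
    and c is nondecreasing, the latest of them has weight at least 1/3. The hull of
    three consecutive convergents therefore shrinks by a factor 26/27 every three
    steps, and it always contains the number expanded.

    Uniqueness: under (i) the tails of a representation stay bounded and away
    from 0, so they converge as well; (i) and (ii) for the next digits force the
    limit (alpha', beta') of a tail to satisfy 0 < beta' < alpha' and alpha' > 1
    strictly. So a_0 and b_0 are the integer parts of alpha and beta, and the
    tail represents the image of (alpha, beta) under one BCF step. *)

Set Implicit Arguments.
Unset Strict Implicit.

Import Order.TTheory GRing.Theory Num.Theory.
Import numFieldNormedType.Exports.

Local Open Scope classical_set_scope.
Local Open Scope ring_scope.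

(** * Convergence of sequences of weighted averages *)

Lemma average3_bounds (R : realType) (l1 l2 l3 c m M x2 x1 x0 : R) :
  c <= l1 -> 0 <= l2 -> 0 <= l3 -> l1 + l2 + l3 = 1 ->
  m <= x2 <= M -> m <= x1 <= M -> m <= x0 <= M ->
  m + c * (x2 - m) <= l1 * x2 + l2 * x1 + l3 * x0 <= M - c * (M - x2).
Proof.
move=> h1 h2 h3 hs /andP[m2 M2] /andP[m1 M1] /andP[m0 M0].
have -> : l1 = 1 - l2 - l3 by lra.
have hl : 0 <= 1 - l2 - l3 - c by lra.
have p2 : 0 <= (1 - l2 - l3 - c) * (x2 - m) by rewrite mulr_ge0// subr_ge0.
have p1 : 0 <= l2 * (x1 - m) by rewrite mulr_ge0// subr_ge0.
have p0 : 0 <= l3 * (x0 - m) by rewrite mulr_ge0// subr_ge0.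
have q2 : 0 <= (1 - l2 - l3 - c) * (M - x2) by rewrite mulr_ge0// subr_ge0.
have q1 : 0 <= l2 * (M - x1) by rewrite mulr_ge0// subr_ge0.
have q0 : 0 <= l3 * (M - x0) by rewrite mulr_ge0// subr_ge0.
by apply/andP; split; lra.
Qed.

Lemma cvg_average3 (R : realType) (x : nat -> R) (z : R) :
  (forall n, exists l1 l2 l3 : R,
     [/\ 3^-1 <= l1, 0 <= l2, 0 <= l3, l1 + l2 + l3 = 1 &
         x n.+3 = l1 * x n.+2 + l2 * x n.+1 + l3 * x n]) ->
  (forall n, exists l1 l2 l3 : R,
     [/\ 0 <= l1, 0 <= l2, 0 <= l3, l1 + l2 + l3 = 1 &
         z = l1 * x n.+2 + l2 * x n.+1 + l3 * x n]) ->
  x n @[n --> \oo] --> z.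
Proof.
move=> hx hz.
pose box m M n := [/\ m <= x n <= M, m <= x n.+1 <= M & m <= x n.+2 <= M].
have next m M n : box m M n ->
    m + 3^-1 * (x n.+2 - m) <= x n.+3 <= M - 3^-1 * (M - x n.+2).
  move=> [b0 b1 b2]; have [l1 [l2 [l3 [h1 h2 h3 hs ->]]]] := hx n.
  exact: average3_bounds.
have boxS m M n : box m M n -> box m M n.+1.
  move=> hb; have hn := next _ _ _ hb; case: hb => b0 b1 b2; split=> //.
  by move: hn b2 => /andP[? ?] /andP[? ?]; apply/andP; split; lra.
have boxz m M n : box m M n -> m <= z <= M.
  move=> [b0 b1 b2]; have [l1 [l2 [l3 [h1 h2 h3 hs ->]]]] := hz n.
  (* No lower bound on the weights of [z] is known, so [c] is 0 here: plain convexity. *)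
  have := average3_bounds h1 h2 h3 hs b2 b1 b0.
  by rewrite !mul0r addr0 subr0.
have shrink m M n : box m M n ->
    exists m' M', M' - m' = (26 / 27) * (M - m) /\ box m' M' n.+3.
  move=> hb; have e1 := next _ _ _ hb; have e2 := next _ _ _ (boxS _ _ _ hb).
  have e3 := next _ _ _ (boxS _ _ _ (boxS _ _ _ hb)).
  case: hb => _ _ b2.
  (* Each new term keeps at least a third of its predecessor's distance to either end of the box.
     After three steps at least 1/27 of the distances of [x n.+2] remains, and these two distances
     add up to [M - m]. *)
  exists (m + (x n.+2 - m) / 27), (M - (M - x n.+2) / 27); split; first by field.
  move: e1 e2 e3 b2 => /andP[? ?] /andP[? ?] /andP[? ?] /andP[? ?].
  by split; apply/andP; split; lra.
pose m0 := Num.min (x 0%N) (Num.min (x 1%N) (x 2%N)).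
pose M0 := Num.max (x 0%N) (Num.max (x 1%N) (x 2%N)).
have boxk k : exists m M,
    M - m = (26 / 27) ^+ k * (M0 - m0) /\ box m M (3 * k)%N.
  elim: k => [|k [m [M [hw hb]]]].
    exists m0, M0; rewrite expr0 mul1r; split=> //.
    by split; rewrite /m0 /M0 !ge_min !le_max !lexx ?orbT.
  have [m' [M' [hw' hb']]] := shrink _ _ _ hb.
  by exists m', M'; rewrite mulnS add3n hw' hw exprS mulrA.
have c1 : `|26 / 27 : R| < 1 by rewrite ger0_norm; lra.
apply/cvgrPdist_le => e e0.
have /cvgrPdist_le /(_ _ e0) [k _ hk] := @cvg_geometric R (M0 - m0) _ c1.
have [m [M [hw hb]]] := boxk k.
have {hk} := hk k (leqnn k); rewrite /= sub0r normrN mulrC -hw => hk.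
exists (3 * k)%N => // j /= kj.
have {}hb : box m M j.
  by rewrite -(subnK kj); elim: (_ - _)%N => // i ih; rewrite addSn; apply: boxS.
have /andP[? ?] := boxz _ _ _ hb.
case: hb => /andP[? ?] _ _.
apply: le_trans hk; apply: le_trans (ler_norm _).
by rewrite ler_norml; apply/andP; split; lra.
Qed.

(** * Convergents as quotients of solutions of a linear recurrence *)

(** The state is a sliding window of three consecutive terms, which makes the third-order recurrence
    structurally recursive. *)
Fixpoint rec3_state (R : realType) (a b : nat -> R) (t : R * R * R) n :=
  if n is m.+1 then
    let: (u, v, w) := rec3_state a b t m in (v, w, a m * w + b m * v + u)
  else t.

Definition rec3 (R : realType) (a b : nat -> R) (t : R * R * R) n : R :=
  (rec3_state a b t n).1.1.

Lemma rec3S (R : realType) (a b : nat -> R) (t : R * R * R) n :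
  rec3 a b t n.+3 =
    a n * rec3 a b t n.+2 + b n * rec3 a b t n.+1 + rec3 a b t n.
Proof. by rewrite /rec3 /=; case: (rec3_state _ _ _ n) => [[u v] w]. Qed.

(* The three sequences hold the numerators and the common denominator of the
   convergents, shifted by 3: index [k] stands for the classical index [k - 3]. *)
Definition ft_numa (R : realType) (a b : nat -> R) := rec3 a b (0, 0, 1).
Definition ft_numb (R : realType) (a b : nat -> R) := rec3 a b (0, 1, 0).
Definition ft_den (R : realType) (a b : nat -> R) := rec3 a b (1, 0, 0).

Section Convergents.
Variables (R : realType) (a b : nat -> R).
Hypothesis a_ge1 : forall i, (0 < i)%N -> 1 <= a i.
Hypothesis b_ge0 : forall i, 0 <= b i.

Let p := ft_numa a b.
Let q := ft_numb a b.
Let c := ft_den a b.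

(** Substituting [a n + y / x] and [b n + 1 / x] and multiplying by [x] turns each linear form into
    the one of the next index. The sign of [x] is asked only for positive [n], because the induction
    ends at [a 0 + y / x], whose sign is unknown. *)
Lemma ft_sum_ratio n x y : ((0 < n)%N -> 0 < x) -> 0 <= y ->
  ft_sum a b n x y =
    ((x * p n.+2 + y * p n.+1 + p n) / (x * c n.+2 + y * c n.+1 + c n),
     (x * q n.+2 + y * q n.+1 + q n) / (x * c n.+2 + y * c n.+1 + c n)).
Proof.
elim: n x y => [|n ih] x y hx hy.
  rewrite /p /q /c /ft_numa /ft_numb /ft_den /rec3 /=.
  by rewrite !(mulr0, mulr1, addr0, add0r, divr1).
have x0 := hx isT.
have ratio (r s : nat -> R) :
    ((a n + y / x) * r n.+2 + (b n + 1 / x) * r n.+1 + r n) /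
    ((a n + y / x) * s n.+2 + (b n + 1 / x) * s n.+1 + s n) =
    (x * (a n * r n.+2 + b n * r n.+1 + r n) + y * r n.+2 + r n.+1) /
    (x * (a n * s n.+2 + b n * s n.+1 + s n) + y * s n.+2 + s n.+1).
  have eqx (t : nat -> R) :
      x * (a n * t n.+2 + b n * t n.+1 + t n) + y * t n.+2 + t n.+1 =
      x * ((a n + y / x) * t n.+2 + (b n + 1 / x) * t n.+1 + t n).
    by field; rewrite gt_eqF.
  (* Splitting off [x / x] cancels it without any claim about the remaining denominator. *)
  by rewrite (eqx r) (eqx s) -[RHS]mulf_div divff ?mul1r// gt_eqF.
have yx : 0 <= y / x by rewrite divr_ge0// ltW.
rewrite /= ih; first by rewrite /p /q /c /ft_numa /ft_numb /ft_den !rec3S !ratio.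
  by move=> n0; have := a_ge1 n0; lra.
by rewrite addr_ge0// divr_ge0// ltW.
Qed.

(** The initial values are 1, 0, 0, so monotonicity starts at index 1. There [a 0] only multiplies
    0, and every later coefficient is at least 1. *)
Lemma ft_den_bounds n : 0 < c n.+3 /\ 0 <= c n.+1 <= c n.+2 /\ c n.+2 <= c n.+3.
Proof.
elim: n => [|n [h1 [/andP[h2 h3] h4]]].
  rewrite /c /ft_den /rec3 /= !(mulr0, addr0, add0r).
  by split; [|split; [apply/andP; split|]]; rewrite ?ler01 ?ltr01.
have h5 : c n.+3 <= c n.+4.
  rewrite {2}/c /ft_den rec3S -/(ft_den _ _) -/c.
  have p1 : 0 <= (a n.+1 - 1) * c n.+3.
    by rewrite mulr_ge0 ?subr_ge0 ?a_ge1// ltW.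
  have p2 : 0 <= b n.+1 * c n.+2 by rewrite mulr_ge0//; lra.
  by lra.
by split; [lra|split=> //; apply/andP; split; lra].
Qed.

Hypothesis b_le : forall i, (0 < i)%N -> b i <= a i.

(** Dividing the recurrence of [r] by that of [c] exhibits each ratio as an average of the three
    before it. The formula for [z] does the same with [x n] and [y n] in place of the digits. *)
Lemma ratio_cvg (r : nat -> R) (z : R) (x y : nat -> R) :
  (forall n, r n.+3 = a n * r n.+2 + b n * r n.+1 + r n) ->
  (forall n, (0 < n)%N -> 0 < x n) -> (forall n, 0 <= y n) ->
  (forall n, z = (x n * r n.+2 + y n * r n.+1 + r n) /
                 (x n * c n.+2 + y n * c n.+1 + c n)) ->
  r n.+3 / c n.+3 @[n --> \oo] --> z.
Proof.
move=> hr hx hy hz.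
have c_gt0 n : 0 < c n.+3 by have [] := ft_den_bounds n.
apply: cvg_average3 => n.
  have [_ [/andP[h1 h2] h3]] := ft_den_bounds n.+2.
  have d0 := c_gt0 n.+3; have d1 := c_gt0 n; have d2 := c_gt0 n.+1.
  have d3 := c_gt0 n.+2.
  have [_ [/andP[_ h4] h5]] := ft_den_bounds n.+1.
  have hc : c n.+3.+3 = a n.+3 * c n.+3.+2 + b n.+3 * c n.+3.+1 + c n.+3.
    by rewrite /c /ft_den rec3S.
  have ha := a_ge1 (isT : (0 < n.+3)%N); have hb0 := b_ge0 n.+3.
  have hb := b_le (isT : (0 < n.+3)%N).
  exists (a n.+3 * c n.+3.+2 / c n.+3.+3), (b n.+3 * c n.+3.+1 / c n.+3.+3),
    (c n.+3 / c n.+3.+3); split.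
  (* Each of the three summands of the new denominator is at most the first one. *)
  - rewrite ler_pdivlMr// hc.
    have p1 : 0 <= (a n.+3 - b n.+3) * c n.+3.+1.
      by rewrite mulr_ge0 ?subr_ge0// ltW.
    have p2 : 0 <= a n.+3 * (c n.+3.+2 - c n.+3.+1).
      by rewrite mulr_ge0 ?subr_ge0//; lra.
    have p3 : 0 <= (a n.+3 - 1) * c n.+3.+2.
      by rewrite mulr_ge0 ?subr_ge0// ltW.
    by lra.
  - by rewrite divr_ge0 ?mulr_ge0// ltW.
  - by rewrite divr_ge0// ltW.
  - by rewrite -!mulrDl -hc divff// gt_eqF.
  - by rewrite hr; field; rewrite ?gt_eqF.
have [d1 d2 d3] : [/\ 0 < c n.+3, 0 < c n.+4 & 0 < c n.+3.+2] by split.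
have [x0 y0] := (hx n.+3 isT, hy n.+3).
have p0 : 0 < x n.+3 * c n.+3.+2 by rewrite mulr_gt0.
have p1 : 0 <= y n.+3 * c n.+4 by rewrite mulr_ge0// ltW.
set D := x n.+3 * c n.+3.+2 + y n.+3 * c n.+4 + c n.+3.
have D0 : 0 < D by rewrite /D; lra.
exists (x n.+3 * c n.+3.+2 / D), (y n.+3 * c n.+4 / D), (c n.+3 / D); split.
- by rewrite divr_ge0// ltW.
- by rewrite divr_ge0// ltW.
- by rewrite divr_ge0// ltW.
- by rewrite -!mulrDl divff// gt_eqF.
- by rewrite (hz n.+3) -/D; field; rewrite ?gt_eqF.
Qed.

Lemma ft_sum_cvg (z w : R) (x y : nat -> R) :
  (forall n, (0 < n)%N -> 0 < x n) -> (forall n, 0 <= y n) ->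
  (forall n, ft_sum a b n (x n) (y n) = (z, w)) ->
  ft_sum a b n (a n) (b n) @[n --> \oo] --> (z, w).
Proof.
move=> hx hy hs.
have -> : (fun n => ft_sum a b n (a n) (b n)) =
          (fun n => (p n.+3 / c n.+3, q n.+3 / c n.+3)).
  apply/funext => n; rewrite ft_sum_ratio//; last first.
    by move=> n0; apply: lt_le_trans (a_ge1 n0).
  by rewrite /p /q /c /ft_numa /ft_numb /ft_den !rec3S.
have hs' n := esym (ft_sum_ratio (hx n) (hy n)).
have hp : p n.+3 / c n.+3 @[n --> \oo] --> z.
  apply: (@ratio_cvg _ _ x y) => // n; first exact: rec3S.
  by have := hs' n; rewrite hs => -[].
have hq : q n.+3 / c n.+3 @[n --> \oo] --> w.
  apply: (@ratio_cvg _ _ x y) => // n; first exact: rec3S.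
  by have := hs' n; rewrite hs => -[].
exact: (cvg_pair hp hq).
Qed.

End Convergents.


(** * Existence: the BCF digits *)

Section Orbit.
Variables (R : realType) (alpha beta : R).
Hypotheses (alpha_gt0 : 0 < alpha) (beta_gt0 : 0 < beta).
Hypothesis infinite : bcf_infinite alpha beta.

Let A := bcf_alpha alpha beta.
Let B := bcf_beta alpha beta.
Let a i := Num.trunc (A i).
Let b i := Num.trunc (B i).

Lemma floor_truncn (x : R) : 0 <= x -> (Num.floor x)%:~R = (Num.trunc x)%:R :> R.
Proof.
by move=> x0; rewrite truncn_floor x0 natr_absz ger0_norm ?floor_ge0.
Qed.

Lemma bcf_orbitS i : 0 <= A i -> 0 <= B i ->
  A i.+1 = 1 / (B i - (b i)%:R) /\
  B i.+1 = (A i - (a i)%:R) / (B i - (b i)%:R).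
Proof. by move=> hA hB; rewrite -!floor_truncn. Qed.

Lemma trunc_frac (x : R) : 0 <= x -> 0 <= x - (Num.trunc x)%:R < 1.
Proof.
by move=> /truncn_itv /andP[h1 h2]; rewrite -natr1 in h2; apply/andP; split; lra.
Qed.

Lemma bcf_frac_beta i : 0 <= B i -> 0 < B i - (b i)%:R < 1.
Proof.
move=> hB; have /andP[h1 h2] := trunc_frac hB.
rewrite h2 lt_neqAle h1 !andbT eq_sym subr_eq0.
apply/eqP => e; have := infinite i.
by rewrite -/(B i) e natr_int.
Qed.

(** The step itself only yields [0 <= B i.+1]; the value 0 is excluded because it is an integer, at
    which the algorithm would stop. *)
Lemma bcf_orbit_gt0 i : 0 < A i /\ 0 < B i.
Proof.
elim: i => [|i [hA hB]]; first by split.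
have [eA eB] := bcf_orbitS (ltW hA) (ltW hB).
have /andP[f0 f1] := bcf_frac_beta (ltW hB).
have /andP[g0 g1] := trunc_frac (ltW hA).
split; first by rewrite eA divr_gt0.
rewrite lt_neqAle eq_sym; apply/andP; split; last by rewrite eB divr_ge0// ltW.
by apply/eqP => e; have := infinite i.+1; rewrite -/(B _) e int_num0.
Qed.

Lemma bcf_orbit_lt i : 1 < A i.+1 /\ B i.+1 < A i.+1.
Proof.
have [hA hB] := bcf_orbit_gt0 i.
have [-> ->] := bcf_orbitS (ltW hA) (ltW hB).
have /andP[f0 f1] := bcf_frac_beta (ltW hB).
have /andP[g0 g1] := trunc_frac (ltW hA).
by split; [rewrite ltr_pdivlMr// mul1r|rewrite ltr_pM2r// invr_gt0].
Qed.

Lemma bcf_digits_admissible i : (0 < i)%N -> (0 < a i)%N /\ (b i <= a i)%N.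
Proof.
case: i => // i _; have [h1 h2] := bcf_orbit_lt i.
have [hA hB] := bcf_orbit_gt0 i.+1.
split; first by rewrite /a truncn_gt0 ltW.
by rewrite /a /b le_truncn// ltW.
Qed.

(** With equal integer parts, [B n < A n] compares the fractional parts, whose quotient [B n.+1] is
    then at least 1. *)
Lemma bcf_digits_eq n : (0 < n)%N -> a n = b n -> b n.+1 <> 0%N.
Proof.
case: n => // n _ e; have [_ h] := bcf_orbit_lt n.
have [hA hB] := bcf_orbit_gt0 n.+1.
have [_ eB] := bcf_orbitS (ltW hA) (ltW hB).
have /andP[f0 f1] := bcf_frac_beta (ltW hB).
apply/eqP; rewrite -lt0n /b truncn_gt0 -/(B _) eB e ler_pdivlMr// mul1r.
by rewrite lerD2r ltW.
Qed.

(** One level of the sum exactly undoes one BCF step, so the [A n], [B n] are the complete quotients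
    of the expansion. *)
Lemma ft_sum_bcf n :
  ft_sum (fun i => (a i)%:R) (fun i => (b i)%:R) n (A n) (B n) = (alpha, beta).
Proof.
elim: n => [|n <-] //=.
have [hA hB] := bcf_orbit_gt0 n.
have [hA1 hB1] := bcf_orbit_gt0 n.+1.
have [eA eB] := bcf_orbitS (ltW hA) (ltW hB).
have /andP[f0 f1] := bcf_frac_beta (ltW hB).
by rewrite eA eB; congr (ft_sum _ _ _ _ _); field; rewrite gt_eqF.
Qed.

Lemma bcf_representation : ft_representation alpha beta a b.
Proof.
apply: (@ft_sum_cvg _ (fun i => (a i)%:R) (fun i => (b i)%:R) _ _ _ _ _ A B).
- by move=> i /bcf_digits_admissible [h _]; rewrite ler1n.
- by move=> i; rewrite ler0n.
- by move=> i /bcf_digits_admissible [_ h]; rewrite ler_nat.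
- by move=> n _; have [] := bcf_orbit_gt0 n.
- by move=> n; rewrite ltW//; have [] := bcf_orbit_gt0 n.
- exact: ft_sum_bcf.
Qed.

End Orbit.

(** * Uniqueness: limits of tails *)

(* Conditions (i) and (ii) reindexed to start at 0, so they are required of the
   shifted sequences [a \o succn] and [b \o succn]. *)
Definition admissible (a b : nat -> nat) : Prop :=
  (forall i, (0 < a i)%N /\ (b i <= a i)%N) /\
  (forall n, a n = b n -> b n.+1 <> 0%N).

Lemma admissibleS a b : admissible a b -> admissible (a \o succn) (b \o succn).
Proof. by move=> [h1 h2]; split=> [i|n]; [exact: h1|exact: h2]. Qed.

(** The definition consumes the last digits first; peeling off the first digits instead makes the
    tail of the representation appear. *)
Lemma ft_sumS (R : realType) (a b : nat -> R) n x y :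
  ft_sum a b n.+1 x y =
  let t := ft_sum (a \o succn) (b \o succn) n x y in
  (a 0%N + t.2 / t.1, b 0%N + 1 / t.1).
Proof. by elim: n x y => [|n ih] x y //; rewrite [LHS]ih. Qed.

Lemma ft_convergentS (R : realType) (a b : nat -> nat) n :
  let t := ft_convergent R (a \o succn) (b \o succn) n in
  ft_convergent R a b n.+1 = ((a 0%N)%:R + t.2 / t.1, (b 0%N)%:R + 1 / t.1).
Proof. exact: ft_sumS. Qed.

(** For [t.2 <= t.1]: if [b 0 < a 0], the integer gap absorbs the reciprocal, which is at most 1. If
    they are equal, (ii) gives [1 <= b 1], so the second entry of the tail is at least 1. *)
Lemma ft_convergent_bounds (R : realType) (a b : nat -> nat) n :
  admissible a b ->
  let t := ft_convergent R a b n in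
  [/\ (a 0%N)%:R <= t.1 <= (a 0%N)%:R + 1, (b 0%N)%:R <= t.2 & t.2 <= t.1].
Proof.
elim: n a b => [|n ih] a b hab /=.
  by rewrite !lexx lerDl ler01 ler_nat; split=> //; case: (hab.1 0%N).
have [] := ih _ _ (admissibleS hab).
rewrite ft_convergentS /=; set t := ft_convergent _ _ _ _.
move=> /andP[h1 h2] h3 h4.
have [a1 _] := hab.1 1%N; rewrite -(ler1n R) in a1.
have t1 : 0 < t.1 by lra.
have b1 := ler0n R (b 1%N).
have d0 : 0 <= t.2 / t.1 by rewrite divr_ge0 ?(ltW t1)//; lra.
have d1 : t.2 / t.1 <= 1 by rewrite ler_pdivrMr// mul1r.
have e0 : 0 < 1 / t.1 by rewrite divr_gt0.
have e1 : 1 / t.1 <= 1 by rewrite ler_pdivrMr// mul1r; lra.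
split; [by apply/andP; split; lra|by lra|].
case: (ltngtP (b 0%N) (a 0%N)) => [lt|gt|e].
- by have := lt; rewrite -(ler_nat R) -natr1; lra.
- by case: (hab.1 0%N) => _; rewrite leqNgt gt.
- rewrite e lerD2l ler_pM2r ?invr_gt0//.
  have := hab.2 0%N (esym e); move/eqP; rewrite -lt0n -(ler1n R).
  by move: h3 => /=; lra.
Qed.

(** The tail convergents are recovered from the full ones by subtracting the first digits and
    inverting, operations continuous at the limit once [beta] is known to differ from [b 0]. *)
Lemma ft_tail_limit (R : realType) (a b : nat -> nat) (alpha beta : R) :
  admissible (a \o succn) (b \o succn) -> ft_representation alpha beta a b ->
  exists alpha' beta' : R,
    [/\ ft_representation alpha' beta' (a \o succn) (b \o succn),
        1 <= alpha', (b 1%N)%:R <= beta' <= alpha',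
        alpha = (a 0%N)%:R + beta' / alpha' & beta = (b 0%N)%:R + 1 / alpha'].
Proof.
move=> hab hr.
pose t n := ft_convergent R (a \o succn) (b \o succn) n.
have tb n := ft_convergent_bounds R n hab.
have a1 : 1 <= (a 1%N)%:R :> R by rewrite ler1n; case: (hab.1 0%N).
have t1 n : 1 <= (t n).1 by have [/andP[+ _] _ _] := tb n; apply: le_trans.
have h1 : (a 0%N)%:R + (t n).2 / (t n).1 @[n --> \oo] --> alpha.
  have -> : (fun n => (a 0%N)%:R + (t n).2 / (t n).1) =
            (fun n => (ft_convergent R a b n.+1).1).
    by apply/funext => n; rewrite ft_convergentS.
  rewrite (cvg_shiftS (fun n => (ft_convergent R a b n).1)).
  exact: (cvg_comp _ _ hr (@cvg_fst _ _ (nbhs alpha) (nbhs beta) _)).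
have h2 : (b 0%N)%:R + 1 / (t n).1 @[n --> \oo] --> beta.
  have -> : (fun n => (b 0%N)%:R + 1 / (t n).1) =
            (fun n => (ft_convergent R a b n.+1).2).
    by apply/funext => n; rewrite ft_convergentS.
  rewrite (cvg_shiftS (fun n => (ft_convergent R a b n).2)).
  exact: (cvg_comp _ _ hr (@cvg_snd _ _ (nbhs alpha) (nbhs beta) _)).
have h3 : (t n).1^-1 @[n --> \oo] --> beta - (b 0%N)%:R.
  have -> : (fun n => (t n).1^-1) =
            (fun n => ((b 0%N)%:R + 1 / (t n).1) - (b 0%N)%:R).
    by apply/funext => n; rewrite div1r addrC addKr.
  by apply: cvgB => //; exact: cvg_cst.
have b0 : 0 < beta - (b 0%N)%:R.
  (* The tails' first entries are at most [a 1 + 1], so their reciprocals stay away from 0. *)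
  apply: (@lt_le_trans _ _ ((a 1%N)%:R + 1)^-1); first by rewrite invr_gt0; lra.
  apply: (cvgr_to_ge h3); near=> n.
  have [/andP[_ h] _ _] := tb n.
  by rewrite lef_pV2 ?posrE//; have := t1 n; lra.
have h4 : (t n).1 @[n --> \oo] --> (beta - (b 0%N)%:R)^-1.
  have -> : (fun n => (t n).1) = (fun n => ((t n).1^-1)^-1).
    by apply/funext => n; rewrite invrK.
  by apply: cvgV => //; rewrite gt_eqF.
have h5 : (t n).2 @[n --> \oo] -->
    (alpha - (a 0%N)%:R) * (beta - (b 0%N)%:R)^-1.
  have -> : (fun n => (t n).2) =
      (fun n => ((a 0%N)%:R + (t n).2 / (t n).1 - (a 0%N)%:R) * (t n).1).
    apply/funext => n; rewrite [X in X - _]addrC addrK divfK// gt_eqF//.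
    by have := t1 n; lra.
  by apply: cvgM h4; apply: cvgB => //; exact: cvg_cst.
exists (beta - (b 0%N)%:R)^-1,
  ((alpha - (a 0%N)%:R) * (beta - (b 0%N)%:R)^-1); split.
- rewrite /ft_representation.
  have -> : ft_convergent R (a \o succn) (b \o succn) =
            (fun n => ((t n).1, (t n).2)).
    by apply/funext => n; rewrite -surjective_pairing.
  exact: (cvg_pair h4 h5).
- by apply: (cvgr_to_ge h4); near=> n.
- apply/andP; split.
    by apply: (cvgr_to_ge h5); near=> n; have [_ ? _] := tb n.
  by apply: (ler_cvg_to h5 h4); near=> n; have [_ _ ?] := tb n.
- by rewrite invrK divfK ?gt_eqF// addrC subrK.
- by rewrite div1r invrK addrC subrK.
Unshelve. all: by end_near.
Qed.

(** Limits preserve only weak inequalities. Strictness comes from writing the limit through that of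
    its tail: the added reciprocal is positive, hence [b 0 < beta], and the same fact for the tail
    makes the other two strict. *)
Lemma ft_limit_lt (R : realType) (a b : nat -> nat) (alpha beta : R) :
  admissible a b -> ft_representation alpha beta a b ->
  [/\ (b 0%N)%:R < beta, 1 < alpha & beta < alpha].
Proof.
have gt0 a' b' (x y : R) : admissible a' b' -> ft_representation x y a' b' ->
    (b' 0%N)%:R < y.
  move=> h hr; have [x' [y' [_ x1 _ _ ->]]] := ft_tail_limit (admissibleS h) hr.
  by rewrite ltrDl divr_gt0//; lra.
move=> hab hr; have hb := gt0 _ _ _ _ hab hr; split=> //.
  have [x [y [hr' x1 _ -> _]]] := ft_tail_limit (admissibleS hab) hr.
  have := gt0 _ _ _ _ (admissibleS hab) hr'.
  have a1 : 1 <= (a 0%N)%:R :> R by rewrite ler1n; case: (hab.1 0%N).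
  move=> /(le_lt_trans (ler0n _ _)) y0.
  have : 0 < y / x by rewrite divr_gt0//; lra.
  by lra.
have [x [y [hr' x1 _ -> ->]]] := ft_tail_limit (admissibleS hab) hr.
have yb := gt0 _ _ _ _ (admissibleS hab) hr'.
have y0 := le_lt_trans (ler0n _ _) yb.
have d0 : 0 < y / x by rewrite divr_gt0//; lra.
have e1 : 1 / x <= 1 by rewrite ler_pdivrMr ?mul1r//; lra.
case: (ltngtP (b 0%N) (a 0%N)) => [lt|gt|e].
- by have := lt; rewrite -(ler_nat R) -natr1; lra.
- by case: (hab.1 0%N) => _; rewrite leqNgt gt.
- rewrite e ltrD2l ltr_pM2r ?invr_gt0//; last by lra.
  have := hab.2 0%N (esym e); move/eqP; rewrite -lt0n -(ler1n R).
  by move: yb => /=; lra.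
Qed.

(** By the strict bounds on the tail limit, [y / x] and [1 / x] lie strictly between 0 and 1. They
    are thus the fractional parts, from which the BCF step returns [x] and [y]. *)
Lemma ft_representation_step (R : realType) (a b : nat -> nat) (alpha beta : R) :
  admissible (a \o succn) (b \o succn) -> ft_representation alpha beta a b ->
  let p := bcf_step (alpha, beta) in
  [/\ a 0%N = Num.trunc alpha, b 0%N = Num.trunc beta &
      ft_representation p.1 p.2 (a \o succn) (b \o succn)].
Proof.
move=> hab hr.
have [x [y [hr' x1 /andP[y0 _] -> ->]]] := ft_tail_limit hab hr.
have [yb {}x1 yx] := ft_limit_lt hab hr'.
have {yb}y0 := le_lt_trans (ler0n _ _) yb.
have x0 : 0 < x by lra.
have d0 : 0 < y / x by rewrite divr_gt0.
have d1 : y / x < 1 by rewrite ltr_pdivrMr// mul1r.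
have e0 : 0 < 1 / x by rewrite divr_gt0.
have e1 : 1 / x < 1 by rewrite ltr_pdivrMr// mul1r.
have ta : Num.trunc ((a 0%N)%:R + y / x) = a 0%N.
  by apply: truncn_def; rewrite -natr1; apply/andP; split; lra.
have tb : Num.trunc ((b 0%N)%:R + 1 / x) = b 0%N.
  by apply: truncn_def; rewrite -natr1; apply/andP; split; lra.
have ha := ler0n R (a 0%N); have hb := ler0n R (b 0%N).
rewrite /bcf_step /= !floor_truncn ?ta ?tb; [|lra..].
split=> //.
by rewrite ![_ + _ / x]addrC !addrK !div1r invrK divfK// gt_eqF//.
Qed.

Lemma ft_representation_digits (R : realType) (a b : nat -> nat)
    (alpha beta : R) :
  admissible (a \o succn) (b \o succn) -> ft_representation alpha beta a b ->
  forall i, a i = Num.trunc (bcf_alpha alpha beta i) /\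
            b i = Num.trunc (bcf_beta alpha beta i).
Proof.
move=> hab hr i; elim: i a b alpha beta hab hr => [|i ih] a b alpha beta hab hr.
  by have [? ? _] := ft_representation_step hab hr.
have [_ _ hr'] := ft_representation_step hab hr.
have := ih _ _ _ _ (admissibleS hab) hr'.
by rewrite /bcf_alpha /bcf_beta iterSr -surjective_pairing.
Qed.

Unset Implicit Arguments.
Set Strict Implicit.

Theorem mainTheorem3 (R : realType) (alpha beta : R)
    (halpha : 0 < alpha) (hbeta : 0 < beta)
    (hinf : bcf_infinite alpha beta) :
  exists! ab : (nat -> nat) * (nat -> nat),
    [/\ ft_representation alpha beta ab.1 ab.2,
        (forall i : nat, (1 <= i)%N ->
           (1 <= ab.1 i)%N /\ (ab.2 i <= ab.1 i)%N) &
        (forall n : nat, (1 <= n)%N ->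
           ab.1 n = ab.2 n -> ab.2 n.+1 <> 0%N)].
Proof.
exists (fun i => Num.trunc (bcf_alpha alpha beta i),
        fun i => Num.trunc (bcf_beta alpha beta i)); split=> /=.
  split.
  - exact: bcf_representation.
  - exact: bcf_digits_admissible.
  - exact: bcf_digits_eq.
move=> [a b] /= [hr h1 h2].
have hab : admissible (a \o succn) (b \o succn).
  by split=> [i|n]; [exact: h1|exact: h2].
by congr pair; apply/funext => i; have [] := ft_representation_digits hab hr i.
Qed.
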